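(* Let $k$ be a field of characteristic zero. There exists a unique family $\{H^{(n)}\mid n\ge1\}$ of homotopies $H^{(n)}$ of the Koszul complexes $K(\Delta_1,\dots,\Delta_n)$ over $k[x_1,y_1,\dots,x_n,y_n]$ satisfying: 1. $H^{(1)}$ is the map $h_1$: for $f\in k[x_1,y_1]$ written uniquely as $f=f_0+\Delta_1f_1$ with $f_0\in k[x_1]$, $H^{(1)}(f)=f_1\theta_1$. 2. For $n>1$ the recursive formula $$H^{(n)}=h+\frac1n\sum_{i=1}^nH^{(n-1)}\circ\mathrm{pr}_i,\qquad h=\frac1n(h_1+\dots+h_n),$$ holds. Each homotopy $H^{(n)}$ contracts the corresponding Koszul complex onto its cohomology, i.e. $d_KH^{(n)}+H^{(n)}d_K=\mathrm{id}-p^{(n)}$, where $d_K$ is the Koszul differential.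
   Context: Put $\Delta_i=y_i-x_i$ and $\widetilde R=k[x_1,y_1,\dots,x_n,y_n]$. The Koszul complex $K(\Delta_1,\dots,\Delta_n)$ is the exterior algebra $\widetilde R\langle\theta_1,\dots,\theta_n\rangle$ on odd variables $\theta_i$ of degree $-1$, with $\widetilde R$-linear differential $d_K$ the odd derivation with $d_K\theta_i=\Delta_i$. A homotopy is a $k$-linear map of degree $-1$ (raising form degree in the $\theta$'s by one). The maps $h_i$: any $f\in\widetilde R$ can be uniquely written $f=f_0+\Delta_if_1$ with $f_0$ not involving $y_i$; set $h_i(f\theta_I)=f_1\,\theta_i\theta_I$ for a monomial $\theta_I$ (which is $0$ if $i\in I$). (This is the map $k[x_i,y_i]\to k[x_i,y_i]\theta_i$, $f\mapsto f_1\theta_i$, extended to the tensor product by the Koszul sign rule.) The maps $\mathrm{pr}_i:K(\Delta_1,\dots,\Delta_n)\to k[x_i]\otimes_kK(\Delta_1,\dots,\widehat{\Delta_i},\dots,\Delta_n)$: $\mathrm{pr}_i\omega$ is obtained from $\omega$ by substituting $x_i$ for $y_i$ and removing all terms that are multiples of $\theta_i$. The target is regarded as a subcomplex of $K(\Delta_1,\dots,\Delta_n)$, and in the recursion $H^{(n-1)}$ denotes the homotopy for the $n-1$ variables other than $i$, extended $k[x_i]$-linearly. The map $p^{(n)}$ is the augmentation $\widetilde R\to\widetilde R/(\Delta_1,\dots,\Delta_n)\cong k[x_1,\dots,x_n]\subset\widetilde R$ in form degree $0$ and is zero in positive form degree; the cohomology of the Koszul complex is $k[x_1,\dots,x_n]$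 in degree $0$. *)

(* Defs.v *)
From HB Require Import structures.
From mathcomp Require Import all_boot all_algebra.
From mathcomp Require Import mpoly ring.

Set Implicit Arguments.
Unset Strict Implicit.
Unset Printing Implicit Defensive.

Import GRing.Theory.
Local Open Scope ring_scope.

(* The ring k[x_1,y_1,...,x_n,y_n] is {mpoly k[n + n]}; x_i has index [xi i]
   and y_i has index [yi i]. *)
Definition xi n (i : 'I_n) : 'I_(n + n) := lshift n i.
Definition yi n (i : 'I_n) : 'I_(n + n) := rshift n i.

(* K(Delta_1,...,Delta_n) is free over the polynomial ring on the monomials
   theta_I = theta_{i_1}...theta_{i_p}, I = {i_1 < ... < i_p}; [w I] is the
   coefficient of theta_I in w. *)
Definition koszul (k : fieldType) (n : nat) :=
  {ffun {set 'I_n} -> {mpoly k[n + n]}}.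

Section Koszul.
Variables (k : fieldType) (n : nat).
Notation Rt := {mpoly k[n + n]}.
Notation K := (koszul k n).
Implicit Types (i j : 'I_n) (I J : {set 'I_n}) (f g : Rt) (w : K).

Definition Delta i : Rt := 'X_(yi i) - 'X_(xi i).

Definition kscale f w : K := [ffun I : {set 'I_n} => f * w I].

(* f theta_J *)
Definition kform f J : K := [ffun I : {set 'I_n} => if I == J then f else 0].

(* theta_i theta_I = ksign i I * theta_(i |: I) for i \notin I *)
Definition ksign i I : Rt := (-1) ^+ #|[set j in I | (j < i)%N]|.

(* left multiplication by theta_i in the exterior algebra *)
Definition theta_mul i w : K :=
  [ffun I : {set 'I_n} => if i \in I then ksign i I * w (I :\ i) else 0].

(* d_K theta_I = \sum_(i in I) ksign i I * Delta_i * theta_(I :\ i), read off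
   coefficientwise; see [koszul_d_kscale], [koszul_d1] and
   [koszul_d_theta_mul] below for the odd derivation property. *)
Definition koszul_d w : K :=
  [ffun I : {set 'I_n} =>
     \sum_(i | i \notin I) ksign i I * Delta i * w (i |: I)].

Definition form_degree (p : nat) w := forall I, #|I| != p -> w I = 0.

Definition is_homotopy (h : K -> K) :=
  linear h /\ forall p w, form_degree p w -> form_degree p.+1 (h w).

Definition y_free i f :=
  all (fun m : 'X_{1..n + n} => m (yi i) == 0%N) (msupp f).

Definition subst_yx i f : Rt :=
  f \mPo [tuple 'X_(if j == yi i then xi i else j) | j < n + n].

Definition subst_all f : Rt :=
  f \mPo [tuple match split j with
                | inl a => 'X_(xi a)
                | inr a => 'X_(xi a)
                end | j < n + n].

(* The target k[x_i] (x) K(.., ^Delta_i, ..) is identified with its image in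
   K(Delta_1,...,Delta_n). *)
Definition pr i w : K :=
  [ffun I : {set 'I_n} => if i \in I then 0 else subst_yx i (w I)].

Definition augm w : K :=
  [ffun I : {set 'I_n} => if I == set0 then subst_all (w set0) else 0].

Lemma y_freeP i f :
  reflect (forall m : 'X_{1..n + n}, m (yi i) != 0%N -> f@_m = 0) (y_free i f).
Proof.
apply: (iffP allP) => h m.
  by move=> hm; apply: contraNeq hm; rewrite -mcoeff_msupp => /h.
by rewrite mcoeff_msupp; apply: contraNT => /h ->.
Qed.

Lemma xi_neq_yi i j : xi i != yi j.
Proof. by rewrite /xi /yi eq_lrshift. Qed.

Lemma y_free_add i f g : y_free i f -> y_free i g -> y_free i (f + g).
Proof.
move=> /y_freeP hf /y_freeP hg; apply/y_freeP => m hm.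
by rewrite mcoeffD hf ?hg ?addr0.
Qed.

Lemma y_free_scale i (c : k) f : y_free i f -> y_free i (c *: f).
Proof.
by move=> /y_freeP hf; apply/y_freeP => m hm; rewrite mcoeffZ hf ?mulr0.
Qed.

Lemma y_free_mulX i (j : 'I_(n + n)) f :
  j != yi i -> y_free i f -> y_free i ('X_j * f).
Proof.
move=> hj /allP hf; apply/allP => m; rewrite mulrC (perm_mem (msuppMX _ _)).
case/mapP => m' /hf /eqP hm' ->.
by rewrite mnmDE hm' mnm1E (negPf hj).
Qed.

Lemma subst_yx_id i f : y_free i f -> subst_yx i f = f.
Proof.
move=> /allP hf; rewrite {2}(mpolyE f) /subst_yx comp_mpolyEX.
apply: eq_big_seq => m /hf /eqP hm; congr (_ *: _).
rewrite comp_mpolyX mpolyXE_id; apply: eq_bigr => j _.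
by rewrite tnth_mktuple; case: eqP => // ->; rewrite hm !expr0.
Qed.

Lemma subst_yx_Delta i : subst_yx i (Delta i) = 0.
Proof.
rewrite /subst_yx comp_mpolyB !comp_mpolyXU -!tnth_nth !tnth_mktuple eqxx.
by rewrite (negPf (xi_neq_yi _ _)) subrr.
Qed.

Lemma Delta_neq0 i : Delta i != 0.
Proof.
apply/eqP => /mpolyP /(_ U_(yi i)%MM) /eqP.
rewrite mcoeffB !mcoeffXU eqxx (negPf (xi_neq_yi _ _)) subr0 mcoeff0.
by rewrite oner_eq0.
Qed.

Lemma quot_ex i f : exists q, y_free i (f - Delta i * q).
Proof.
pose P g := exists q, y_free i (g - Delta i * q).
have PX (j : 'I_(n + n)) g : P g -> P ('X_j * g).
  case=> q hq; have [->|hj] := eqVneq j (yi i).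
    exists (g - Delta i * q + 'X_(yi i) * q).
    have -> : 'X_(yi i) * g - Delta i * (g - Delta i * q + 'X_(yi i) * q)
            = 'X_(xi i) * (g - Delta i * q).
      by rewrite /Delta; ring.
    exact: y_free_mulX (xi_neq_yi _ _) hq.
  exists ('X_j * q); rewrite mulrCA -mulrBr; exact: y_free_mulX.
have PXn (j : 'I_(n + n)) e g : P g -> P ('X_j ^+ e * g).
  by elim: e => [|e IH] Pg; rewrite ?expr0 ?mul1r // exprS -mulrA; apply/PX/IH.
have P1 : P 1.
  exists 0; rewrite mulr0 subr0; apply/allP => m.
  by rewrite msupp1 inE => /eqP ->; rewrite mnm0E.
elim/mpolyind: f => [|c m p _ _ [q hq]].
  by exists 0; rewrite mulr0 subr0; apply/allP => m; rewrite msupp0.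
have [r hr] : P 'X_[m].
  rewrite mpolyXE_id; by apply: big_rec => // j g _; apply: PXn.
exists (c *: r + q); rewrite mulrDr opprD addrACA -scalerAr -scalerBr.
by apply: y_free_add => //; apply: y_free_scale.
Qed.

(* the f1 of f = f0 + Delta_i f1 with f0 free of y_i; see [quotP] and
   [quot_unique] *)
Definition quot i f : Rt := xchoose (quot_ex i f).

Lemma quotP i f : y_free i (f - Delta i * quot i f).
Proof. exact: (xchooseP (quot_ex i f)). Qed.

Lemma quot_unique i f0 f1 : y_free i f0 -> quot i (f0 + Delta i * f1) = f1.
Proof.
move=> h0; set f := f0 + _; have := quotP i f; set q := quot i f => hq.
have: y_free i (Delta i * (q - f1)).
  have -> : Delta i * (q - f1) = f0 + (-1) *: (f - Delta i * q).
    by rewrite scaleN1r /f; ring.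
  by apply: y_free_add => //; apply: y_free_scale.
move/subst_yx_id; rewrite {1}/subst_yx rmorphM /= -/(subst_yx i (Delta i)).
rewrite subst_yx_Delta mul0r => /esym/eqP.
by rewrite mulf_eq0 (negPf (Delta_neq0 i)) subr_eq0 => /eqP.
Qed.

(* f theta_I |-> f1 theta_i theta_I *)
Definition hmap i w : K :=
  theta_mul i [ffun I : {set 'I_n} => quot i (w I)].

Definition hmean w : K := n%:R^-1 *: \sum_(i < n) hmap i w.

Lemma ksignD1 i I : ksign i (I :\ i) = ksign i I.
Proof.
rewrite /ksign; congr (_ ^+ _); apply: eq_card => j; rewrite !inE.
by case: eqVneq => // ->; rewrite ltnn !andbF.
Qed.

Lemma ksignU1 i j I : j \notin I ->
  ksign i (j |: I) = (-1) ^+ (j < i)%N * ksign i I.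
Proof.
move=> hj; rewrite /ksign -exprD; congr (_ ^+ _).
case: ltnP => hji.
  rewrite add1n.
  have -> : [set l in j |: I | (l < i)%N] = j |: [set l in I | (l < i)%N].
    by apply/setP => l; rewrite !inE; case: eqVneq => // ->.
  by rewrite cardsU1 inE (negPf hj).
apply: eq_card => l; rewrite !inE.
by case: eqVneq => // ->; rewrite ltnNge hji /= andbF.
Qed.

Lemma ksign_sq i I : ksign i I * ksign i I = 1.
Proof. by rewrite /ksign -expr2 sqrr_sign. Qed.

Lemma theta_mul_kform i f I : i \notin I ->
  theta_mul i (kform f I) = kform (ksign i I * f) (i |: I).
Proof.
move=> hi; apply/ffunP => J; rewrite !ffunE.
case: ifPn => hJ.
  rewrite -ksignD1; have [->|hne] := eqVneq J (i |: I).
    by rewrite setU1K // eqxx.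
  case: eqP => [e|]; rewrite ?mulr0 //; case/eqP: hne.
  by rewrite -e setD1K.
by case: eqP => // e; case/negP: hJ; rewrite e setU11.
Qed.

Lemma theta_mul_anticomm i j w :
  theta_mul i (theta_mul j w) = - theta_mul j (theta_mul i w).
Proof.
apply/ffunP => I; rewrite !ffunE !in_setD1.
have [<-{j}|hij] := eqVneq i j.
  by case: (i \in I); rewrite ?eqxx /= ?mulr0 ?oppr0.
rewrite /=.
case hi: (i \in I); case hj: (j \in I); rewrite ?mulr0 ?oppr0 //.
have -> : ksign i I = (-1) ^+ (j < i)%N * ksign i (I :\ j).
  by rewrite -{1}(setD1K hj) ksignU1 // !inE eqxx.
have -> : ksign j I = (-1) ^+ (i < j)%N * ksign j (I :\ i).
  by rewrite -{1}(setD1K hi) ksignU1 // !inE eqxx.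
rewrite setDDl setUC -setDDl.
move: hij; rewrite -val_eqE /=; case: ltngtP => //= _ _; rewrite !expr0 !expr1.
  by ring.
by ring.
Qed.

Lemma theta_mul_sq i w : theta_mul i (theta_mul i w) = 0.
Proof.
apply/ffunP => I; rewrite !ffunE setD11 mulr0; exact: if_same.
Qed.

Lemma koszul_d_kscale f w : koszul_d (kscale f w) = kscale f (koszul_d w).
Proof.
apply/ffunP => I; rewrite !ffunE mulr_sumr; apply: eq_bigr => i _.
by rewrite !ffunE mulrCA.
Qed.

Lemma koszul_d1 : koszul_d (kform 1 set0) = 0.
Proof.
apply/ffunP => I; rewrite !ffunE big1 // => i _; rewrite !ffunE.
by rewrite -subset0 subUset sub1set inE mulr0.
Qed.

Lemma koszul_d_theta_mul i w :
  koszul_d (theta_mul i w) = kscale (Delta i) w - theta_mul i (koszul_d w).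
Proof.
apply/ffunP => I; rewrite !ffunE; case: ifPn => hi; last first.
  rewrite subr0 (bigD1 i) //= big1 ?addr0.
    rewrite !ffunE setU11 setU1K // -[ksign i (i |: I)]ksignD1 setU1K //.
    by rewrite mulrACA ksign_sq mul1r.
  move=> j /andP [hj hij]; rewrite ffunE in_setU1 eq_sym (negPf hij) (negPf hi).
  by rewrite mulr0.
rewrite [in RHS](bigD1 i) ?inE ?eqxx //= setD1K // mulrDr opprD addrA.
rewrite ksignD1 !mulrA ksign_sq mul1r subrr add0r mulr_sumr -sumrN.
apply: eq_big => [j|j hj].
  by rewrite !inE negb_and negbK; case: eqVneq => [->|]; rewrite ?hi //= andbT.
have hij : i != j by apply: contraNneq hj => <-.
rewrite !ffunE in_setU1 hi orbT.
have -> : (j |: I) :\ i = j |: (I :\ i).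
  apply/setP => l; rewrite !inE; case: (eqVneq l j) => // ->.
  by rewrite eq_sym hij.
rewrite ksignU1 //.
have -> : ksign j I = (-1) ^+ (i < j)%N * ksign j (I :\ i).
  by rewrite -{1}(setD1K hi) ksignU1 // !inE eqxx.
move: hij; rewrite -val_eqE /=; case: ltngtP => //= _ _; rewrite !expr0 !expr1.
  by ring.
by ring.
Qed.

End Koszul.

Section Extension.
Variables (k : fieldType) (n : nat).
Implicit Types (i : 'I_n.+1) (w : koszul k n).

(* The variables x_j, y_j, theta_j with j <> i are numbered by [lift i]. *)
Definition vlift i (j : 'I_(n + n)) : 'I_(n.+1 + n.+1) :=
  match split j with
  | inl a => xi (lift i a)
  | inr a => yi (lift i a)
  end.

(* inclusion of the Koszul complex on the variables other than i *)
Definition embed i w : koszul k n.+1 :=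
  [ffun I : {set 'I_n.+1} =>
     if i \in I then 0
     else w (lift i @^-1: I) \mPo [tuple 'X_(vlift i j) | j < n + n]].

Definition mrestr i (m : 'X_{1..n.+1 + n.+1}) : 'X_{1..n + n} :=
  [multinom m (vlift i j) | j < n + n].

(* The k[x_i]-linear extension of H, by its values on the basis
   x_i^a * embed i (m theta_J) of k[x_i] (x) K(.., ^Delta_i, ..); terms of [w]
   outside this subcomplex are sent to 0.  See [ext_embed]. *)
Definition ext i (H : koszul k n -> koszul k n) (w : koszul k n.+1) :
    koszul k n.+1 :=
  \sum_(I : {set 'I_n.+1} | i \notin I)
    \sum_(m <- msupp (w I) | m (yi i) == 0%N)
      (w I)@_m *: kscale ('X_(xi i) ^+ m (xi i))
                         (embed i (H (kform 'X_[mrestr i m] (lift i @^-1: I)))).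

(* The monomial x_i^a * (m with variables renamed by [vlift i]). *)
Definition mext i a (m : 'X_{1..n + n}) : 'X_{1..n.+1 + n.+1} :=
  (U_(xi i) *+ a + \sum_(j < n + n) U_(vlift i j) *+ m j)%MM.

Lemma vlift_inj i : injective (vlift i).
Proof.
move=> j1 j2; rewrite /vlift -{2}(splitK j1) -{2}(splitK j2).
case: (split j1) => a1; case: (split j2) => a2; rewrite /xi /yi.
- by move/lshift_inj/lift_inj => ->.
- by move/eqP; rewrite eq_lrshift.
- by move/eqP; rewrite eq_rlshift.
- by move/rshift_inj/lift_inj => ->.
Qed.

Lemma vlift_neq_xi i j : vlift i j != xi i.
Proof.
rewrite /vlift; case: split => a; rewrite /xi /yi ?eq_rlshift // eq_lshift.
by rewrite eq_sym neq_lift.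
Qed.

Lemma vlift_neq_yi i j : vlift i j != yi i.
Proof.
rewrite /vlift; case: split => a; rewrite /xi /yi ?eq_lrshift // eq_rshift.
by rewrite eq_sym neq_lift.
Qed.

Lemma mextE i a m l :
  mext i a m l = ((xi i == l) * a + \sum_(j < n + n) (vlift i j == l) * m j)%N.
Proof.
rewrite /mext mnmDE mulmnE mnm1E mnm_sumE; congr (_ + _)%N.
by apply: eq_bigr => j _; rewrite mulmnE mnm1E.
Qed.

Lemma mext_xi i a m : mext i a m (xi i) = a.
Proof.
rewrite mextE eqxx mul1n big1 ?addn0 // => j _.
by rewrite (negPf (vlift_neq_xi _ _)).
Qed.

Lemma mext_yi i a m : mext i a m (yi i) = 0%N.
Proof.
rewrite mextE (negPf (xi_neq_yi _ _)) big1 // => j _.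
by rewrite (negPf (vlift_neq_yi _ _)).
Qed.

Lemma mextK i a : cancel (mext i a) (mrestr i).
Proof.
move=> m; apply/mnmP => j; rewrite mnmE mextE eq_sym (negPf (vlift_neq_xi _ _)).
rewrite (bigD1 j) //= eqxx mul1n big1 ?addn0 // => j' hj.
by rewrite (inj_eq (@vlift_inj i)) (negPf hj).
Qed.

Lemma rename_mpolyE i a (p : {mpoly k[n + n]}) :
  'X_(xi i) ^+ a * (p \mPo [tuple 'X_(vlift i j) | j < n + n])
  = \sum_(m <- msupp p) p@_m *: 'X_[mext i a m].
Proof.
rewrite comp_mpolyEX mulr_sumr; apply: eq_bigr => m _.
rewrite -scalerAr comp_mpolyX /mext mpolyXD mpolyXn; congr (_ *: (_ * _)).
by rewrite -mprodXE; apply: eq_bigr => j _; rewrite tnth_mktuple mpolyXn.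
Qed.

Lemma embed_is_linear i : linear (embed i).
Proof.
move=> c u v; apply/ffunP => I; rewrite !ffunE; case: ifP => _.
  by rewrite scaler0 addr0.
by rewrite comp_mpolyD comp_mpolyZ.
Qed.

Lemma kscale_is_linear m (f : {mpoly k[m + m]}) : linear (@kscale k m f).
Proof.
by move=> c u v; apply/ffunP => I; rewrite !ffunE mulrDr scalerAr.
Qed.

Lemma kform_is_linear m (J : {set 'I_m}) :
  linear (fun f : {mpoly k[m + m]} => kform f J).
Proof.
move=> c u v; apply/ffunP => I; rewrite !ffunE; case: ifP => // _.
by rewrite scaler0 addr0.
Qed.

Lemma ext_embed i (H : koszul k n -> koszul k n) (a : nat) w : linear H ->
  ext i H (kscale ('X_(xi i) ^+ a) (embed i w))
  = kscale ('X_(xi i) ^+ a) (embed i (H w)).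
Proof.
move=> linH.
pose L J p : koszul k n.+1 :=
  kscale ('X_(xi i) ^+ a) (embed i (H (kform p J))).
have linL J : linear (L J).
  move=> c u v.
  by rewrite /L kform_is_linear linH embed_is_linear kscale_is_linear.
pose LL J : {linear {mpoly k[n + n]} -> koszul k n.+1} :=
  HB.pack (L J) (GRing.isLinear.Build _ _ _ _ (L J) (linL J)).
rewrite /ext.
transitivity (\sum_(I : {set 'I_n.+1} | i \notin I)
                L (lift i @^-1: I) (w (lift i @^-1: I))).
  apply: eq_bigr => I hI.
  set J := lift i @^-1: I; set p := w J.
  have -> : kscale ('X_(xi i) ^+ a) (embed i w) I
          = \sum_(m <- msupp p) p@_m *: 'X_[mext i a m].
    by rewrite !ffunE (negPf hI) rename_mpolyE.
  set q := \sum_(m <- _) _.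
  have inj_mext : injective (mext i a) by exact: can_inj (@mextK i a).
  have qE m : q@_(mext i a m) = p@_m.
    rewrite /q raddf_sum /= [in RHS](mpolyE p) raddf_sum /=.
    apply: eq_bigr => m' _; rewrite !mcoeffZ !mcoeffX.
    by rewrite (inj_eq inj_mext).
  have perm_q : perm_eq (msupp q) (map (mext i a) (msupp p)).
    apply: uniq_perm => [||m]; rewrite ?(map_inj_uniq inj_mext) ?msupp_uniq //.
    apply/idP/mapP => [|[m' hm' ->]]; last by rewrite mcoeff_msupp qE -mcoeff_msupp.
    rewrite mcoeff_msupp /q raddf_sum /= => hne.
    have [m' hm' e] : exists2 m', m' \in msupp p & mext i a m' == m.
      apply/hasP; apply: contraNT hne => /hasPn hn.
      rewrite big_seq big1 // => m' /hn hm'.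
      by rewrite mcoeffZ mcoeffX (negPf hm') mulr0.
    by exists m' => //; rewrite (eqP e).
  rewrite (perm_big _ perm_q) big_map /=.
  transitivity (LL J p); last by [].
  rewrite [in RHS](mpolyE p) linear_sum.
  apply: eq_big => [m|m _]; first by rewrite mext_yi eqxx.
  by rewrite linearZ /= qE mext_xi mextK.
transitivity (\sum_(J : {set 'I_n}) L J (w J)).
  rewrite (reindex (fun J : {set 'I_n} => lift i @: J)) /=; last first.
    exists (fun I : {set 'I_n.+1} => lift i @^-1: I) => [J _|I].
      by apply/setP => j; rewrite inE mem_imset //; exact: lift_inj.
    rewrite inE => hI; apply/setP => j; apply/imsetP/idP => [[l]|hj].
      by rewrite inE => ? ->.
    case: (unliftP i j) hj => [l ->|->]; last by rewrite (negPf hI).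
    by exists l; rewrite ?inE.
  apply: eq_big => [J|J _].
    by apply/negP => /imsetP [j _ /eqP]; rewrite (negPf (neq_lift _ _)).
  have -> // : lift i @^-1: (lift i @: J) = J.
  by apply/setP => j; rewrite inE mem_imset //; exact: lift_inj.
pose M (u : koszul k n) := kscale ('X_(xi i) ^+ a) (embed i (H u)).
have linM : linear M.
  by move=> c u v; rewrite /M linH embed_is_linear kscale_is_linear.
pose LM : {linear koszul k n -> koszul k n.+1} :=
  HB.pack M (GRing.isLinear.Build _ _ _ _ M linM).
rewrite -/(M w) -[M w]/(LM w).
have -> : w = \sum_(J : {set 'I_n}) kform (w J) J.
  apply/ffunP => I; rewrite sum_ffunE (bigD1 I) //= ffunE eqxx big1 ?addr0 //.
  by move=> J hJ; rewrite ffunE eq_sym (negPf hJ).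
rewrite linear_sum; apply: eq_bigr => J _.
rewrite /L /= /M.
rewrite sum_ffunE (bigD1 J) //= ffunE eqxx big1 ?addr0 // => J' hJ.
by rewrite ffunE eq_sym (negPf hJ).
Qed.

End Extension.

(* Only the components H n with n >= 1 are constrained; H 0 is a dummy. *)
Definition homotopy_family (k : fieldType)
    (H : forall n, koszul k n -> koszul k n) :=
  [/\ forall n, (0 < n)%N -> is_homotopy (H n),
      forall w, H 1%N w = hmap ord0 w
    & forall n, (0 < n)%N -> forall w, H n.+1 w =
        hmean w + n.+1%:R^-1 *: \sum_(i < n.+1) ext i (H n) (pr i w)].

Definition contracts (k : fieldType) n (H : koszul k n -> koszul k n) :=
  forall w, koszul_d (H w) + H (koszul_d w) = w - augm w.

(* Main.v *)
(* Each h_i is a homotopy between id and pr_i.  The map pr_i commutes with d_K,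
   and on its image the k[x_i]-linear extension of H^(n-1) is by induction a
   homotopy between id and the augmentation p, so that H^(n-1) o pr_i is a
   homotopy between pr_i and p o pr_i = p.  Averaging
   (id - pr_i) + (pr_i - p) = id - p over i gives the claim for H^(n).  The
   recursion can be started at H^(0) = 0, which contracts K() = k and for which
   it yields H^(1) = h_1. *)

From HB Require Import structures.
From mathcomp Require Import all_boot all_algebra.
From mathcomp Require Import mpoly ring.
Require Import Defs.

Set Implicit Arguments.
Unset Strict Implicit.
Unset Printing Implicit Defensive.

Import GRing.Theory.
Local Open Scope ring_scope.

(** * Substitutions and sums over supports of polynomials *)

Lemma comp_mpolyA (R : comRingType) n m l (s : n.-tuple {mpoly R[m]})
    (t : m.-tuple {mpoly R[l]}) (p : {mpoly R[n]}) :
  (p \mPo s) \mPo t = p \mPo [tuple (tnth s i \mPo t) | i < n].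
Proof.
rewrite !(comp_mpolyEX p) raddf_sum; apply: eq_bigr => e _.
rewrite /= comp_mpolyZ !comp_mpolyX rmorph_prod; congr (_ *: _).
by apply: eq_bigr => i _; rewrite rmorphXn /= tnth_mktuple.
Qed.

Lemma big_msupp_widen (R : nzRingType) n (V : lmodType R) (p : {mpoly R[n]})
    (r : seq 'X_{1..n}) (P : pred 'X_{1..n}) (F : 'X_{1..n} -> V) :
    uniq r -> {subset msupp p <= r} ->
  \sum_(m <- msupp p | P m) p@_m *: F m = \sum_(m <- r | P m) p@_m *: F m.
Proof.
move=> uniq_r sub_r.
rewrite [RHS](bigID (mem (msupp p))) /= [X in _ = _ + X]big1 ?addr0; last first.
  by move=> m /andP[_]; rewrite mcoeff_msupp negbK => /eqP ->; rewrite scale0r.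
rewrite -big_filter -[RHS]big_filter; apply: perm_big.
apply: uniq_perm; rewrite ?filter_uniq ?msupp_uniq // => m.
rewrite !mem_filter; case mp: (m \in msupp p); rewrite ?andbF ?andbT //=.
by rewrite (sub_r _ mp) andbT.
Qed.

Lemma split_xi n (i : 'I_n) : split (xi i) = inl i.
Proof. exact: (unsplitK (inl i)). Qed.

Lemma split_yi n (i : 'I_n) : split (yi i) = inr i.
Proof. exact: (unsplitK (inr i)). Qed.

(** * The maps [quot], [hmap], [pr], [augm] and the differential on one Koszul complex *)

Section OneComplex.
Variables (k : fieldType) (n : nat).
Notation K := (koszul k n).
Implicit Types (i j : 'I_n) (I : {set 'I_n}) (f g : {mpoly k[n + n]}) (w : K).

(** Substituting x_i for y_i fixes the y_i-free remainder and kills Delta_i. *)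
Lemma subst_yxE i f : subst_yx i f = f - Delta k i * quot i f.
Proof.
rewrite -(subst_yx_id (quotP i f)) /subst_yx rmorphB rmorphM /=.
by rewrite -/(subst_yx i (Delta k i)) subst_yx_Delta mul0r subr0.
Qed.

Lemma y_free_subst_yx i f : y_free i (subst_yx i f).
Proof. by rewrite subst_yxE quotP. Qed.

Lemma quot_eq i f g : y_free i (f - Delta k i * g) -> quot i f = g.
Proof. by move=> h; rewrite -[f in LHS](subrK (Delta k i * g)) quot_unique. Qed.

Lemma quot_is_linear i : linear (@quot k n i).
Proof.
move=> c f g; apply: quot_eq.
have -> : c *: f + g - Delta k i * (c *: quot i f + quot i g)
        = c *: (f - Delta k i * quot i f) + (g - Delta k i * quot i g).
  by rewrite mulrDr -scalerAr scalerBr opprD addrACA.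
by apply: y_free_add; [apply: y_free_scale|]; apply: quotP.
Qed.

HB.instance Definition _ i :=
  GRing.isLinear.Build k _ _ _ (@quot k n i) (quot_is_linear i).

Lemma subst_yx_Delta_neq i j : i != j -> subst_yx i (Delta k j) = Delta k j.
Proof.
move=> hij; rewrite /subst_yx comp_mpolyB !comp_mpolyXU -!tnth_nth !tnth_mktuple.
by rewrite (negPf (xi_neq_yi _ _)) /yi eq_rshift eq_sym (negPf hij).
Qed.

Lemma quot_Delta i f : quot i (Delta k i * f) = f.
Proof.
by apply: quot_eq; rewrite subrr; apply/y_freeP => m _; rewrite mcoeff0.
Qed.

Lemma quot_Delta_neq i j f :
  i != j -> quot i (Delta k j * f) = Delta k j * quot i f.
Proof.
move=> hij; apply: quot_eq; rewrite mulrCA -mulrBr -subst_yxE.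
(* The remainder is Delta_j times [subst_yx i f]; as Delta_j is its own substitution, the product is
   a value of [subst_yx i], hence y_i-free. *)
rewrite -(subst_yx_Delta_neq hij) /subst_yx -rmorphM.
exact: y_free_subst_yx.
Qed.

(** The sign is a polynomial equal to 1 or -1, so it passes through maps that are only k-linear. *)
Lemma linear_ksign i I f
    (h : {linear {mpoly k[n + n]} -> {mpoly k[n + n]}}) :
  h (ksign k i I * f) = ksign k i I * h f.
Proof.
by rewrite /ksign -signr_odd; case: odd; rewrite ?mulN1r ?mul1r ?linearN.
Qed.

Lemma theta_mul_is_linear i : linear (@theta_mul k n i).
Proof.
move=> c u v; apply/ffunP => I; rewrite !ffunE; case: ifP => _.
  by rewrite mulrDr scalerAr.
by rewrite scaler0 addr0.
Qed.

Lemma hmap_is_linear i : linear (@hmap k n i).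
Proof.
move=> c u v; rewrite -theta_mul_is_linear; congr theta_mul.
by apply/ffunP => I; rewrite !ffunE linearP.
Qed.

Lemma hmean_is_linear : linear (@hmean k n).
Proof.
move=> c u v; rewrite /hmean scalerA mulrC -scalerA -scalerDr.
congr (_ *: _); rewrite scaler_sumr -big_split.
by apply: eq_bigr => i _; rewrite hmap_is_linear.
Qed.

Lemma koszul_d_is_linear : linear (@koszul_d k n).
Proof.
move=> c u v; apply/ffunP => I; rewrite !ffunE scaler_sumr -big_split.
by apply: eq_bigr => i _; rewrite !ffunE mulrDr -scalerAr.
Qed.

Lemma pr_is_linear i : linear (@pr k n i).
Proof.
move=> c u v; apply/ffunP => I; rewrite !ffunE; case: ifP => _.
  by rewrite scaler0 addr0.
by rewrite /subst_yx linearP.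
Qed.

Lemma augm_is_linear : linear (@augm k n).
Proof.
move=> c u v; apply/ffunP => I; rewrite !ffunE; case: ifP => _.
  by rewrite /subst_all linearP.
by rewrite scaler0 addr0.
Qed.

HB.instance Definition _ i :=
  GRing.isLinear.Build k K K _ (@hmap k n i) (hmap_is_linear i).
HB.instance Definition _ :=
  GRing.isLinear.Build k K K _ (@hmean k n) hmean_is_linear.
HB.instance Definition _ :=
  GRing.isLinear.Build k K K _ (@koszul_d k n) koszul_d_is_linear.
HB.instance Definition _ i :=
  GRing.isLinear.Build k K K _ (@pr k n i) (pr_is_linear i).
HB.instance Definition _ :=
  GRing.isLinear.Build k K K _ (@augm k n) augm_is_linear.

Lemma hmap_degree i p w : form_degree p w -> form_degree p.+1 (hmap i w).
Proof.
move=> hw I hI; rewrite !ffunE; case: ifP => // iI; rewrite hw ?linear0 ?mulr0 //.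
by apply: contraNneq hI => <-; rewrite (cardsD1 i) iI.
Qed.

Lemma pr_degree i p w : form_degree p w -> form_degree p (pr i w).
Proof.
by move=> hw I hI; rewrite ffunE; case: ifP => // _; rewrite hw // /subst_yx linear0.
Qed.

(** The substitution kills Delta_i, matching the removal of theta_i, and fixes every other
    Delta_j. *)
Lemma koszul_d_pr i w : koszul_d (pr i w) = pr i (koszul_d w).
Proof.
apply/ffunP => I; rewrite !ffunE; case: ifPn => iI.
  by rewrite big1 // => j jI; rewrite ffunE in_setU1 iI orbT mulr0.
rewrite /subst_yx linear_sum; apply: eq_bigr => j jI /=.
rewrite -!mulrA linear_ksign ffunE in_setU1 (negPf iI) orbF.
congr (_ * _); rewrite rmorphM /= -!/(subst_yx _ _).
by have [<-|hij] := eqVneq i j; rewrite ?subst_yx_Delta ?mul0r ?mulr0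
  ?subst_yx_Delta_neq.
Qed.

(** Division by Delta_i commutes with every summand of d_K except j = i, where it cancels the factor
    Delta_i; the y_i-free part left over is the correction term. *)
Lemma quot_koszul_d i w I : i \notin I ->
  quot i (koszul_d w I)
  = koszul_d [ffun J : {set 'I_n} => quot i (w J)] I
    + ksign k i I * (w (i |: I) - Delta k i * quot i (w (i |: I))).
Proof.
move=> iI; rewrite !ffunE linear_sum (bigD1 i) //= [in RHS](bigD1 i) //=.
rewrite -mulrA linear_ksign /= quot_Delta ffunE.
rewrite [X in _ + X = _](_ : _ = \sum_(j | (j \notin I) && (j != i))
   ksign k j I * Delta k j * [ffun J : {set 'I_n} => quot i (w J)] (j |: I)).
  by ring.
apply: eq_bigr => j /andP[_ ji].
by rewrite -!mulrA linear_ksign /= quot_Delta_neq 1?eq_sym // ffunE.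
Qed.

(** By the derivation rule for theta_i, coefficients with i outside I reduce to f = f_0 + Delta_i
    f_1; for i in I the correction term of [quot_koszul_d] completes Delta_i f_1 to f. *)
Lemma hmap_contracts i w :
  koszul_d (hmap i w) + hmap i (koszul_d w) = w - pr i w.
Proof.
rewrite /hmap koszul_d_theta_mul; apply/ffunP => I.
rewrite 2!ffunE [kscale _ _ I]ffunE [(- theta_mul _ _) I]ffunE.
rewrite [theta_mul i (koszul_d _) I]ffunE [theta_mul i [ffun _ => _] I]ffunE.
rewrite [(w - _) I]ffunE [(- pr i w) I]ffunE [pr i w I]ffunE.
case: ifPn => iI.
  rewrite [in X in _ + X]ffunE quot_koszul_d ?setD11 // setD1K // ksignD1 ffunE.
  rewrite mulrDr [X in _ - _ + (_ + X)]mulrA ksign_sq; ring.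
by rewrite ffunE subst_yxE; ring.
Qed.

Lemma subst_all_subst_yx i f : subst_all (subst_yx i f) = subst_all f.
Proof.
rewrite /subst_all /subst_yx comp_mpolyA; congr comp_mpoly.
apply: eq_from_tnth => j; rewrite !tnth_mktuple comp_mpolyXU -tnth_nth tnth_mktuple.
by case: eqP => // ->; rewrite split_xi split_yi.
Qed.

Lemma augm_pr i w : augm (pr i w) = augm w.
Proof. by apply/ffunP => I; rewrite !ffunE inE subst_all_subst_yx. Qed.

End OneComplex.

(** * The k[x_i]-linear extension and the subcomplex without y_i and theta_i *)

Section Extension.
Variables (k : fieldType) (n : nat).
Implicit Types (i : 'I_n.+1) (I : {set 'I_n.+1}) (H : koszul k n -> koszul k n).

HB.instance Definition _ m (f : {mpoly k[m + m]}) :=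
  GRing.isLinear.Build k (koszul k m) (koszul k m) _ (kscale f)
    (kscale_is_linear f).
HB.instance Definition _ i :=
  GRing.isLinear.Build k (koszul k n) (koszul k n.+1) _ (embed i)
    (@embed_is_linear k n i).

(** Only the coefficients of the argument vary, as [H] is applied to fixed monomial forms. Supports
    are not additive, so the sums are first moved to one common list of monomials. *)
Lemma ext_is_linear i H : linear (ext i H).
Proof.
move=> c u v; rewrite /ext scaler_sumr -big_split; apply: eq_bigr => I _ /=.
pose r := undup (msupp ((c *: u + v) I) ++ msupp (u I) ++ msupp (v I)).
have uniq_r : uniq r by apply: undup_uniq.
rewrite !(big_msupp_widen _ _ uniq_r); try by
  move=> m hm; rewrite mem_undup !mem_cat hm ?orbT.
rewrite scaler_sumr -big_split; apply: eq_bigr => m _ /=.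
by rewrite !ffunE mcoeffD mcoeffZ scalerDl scalerA.
Qed.

HB.instance Definition _ i H :=
  GRing.isLinear.Build k (koszul k n.+1) (koszul k n.+1) _ (ext i H)
    (ext_is_linear i H).

Lemma eq_ext i H H' : H =1 H' -> ext i H =1 ext i H'.
Proof.
move=> eqH w; apply: eq_bigr => I _; apply: eq_bigr => m _.
by rewrite eqH.
Qed.

Lemma kscale_degree m (f : {mpoly k[m + m]}) p (w : koszul k m) :
  form_degree p w -> form_degree p (kscale f w).
Proof. by move=> hw I hI; rewrite ffunE hw // mulr0. Qed.

(** [lift i] is injective and misses only [i]. *)
Lemma card_preim_lift i I : i \notin I -> #|lift i @^-1: I| = #|I|.
Proof.
move=> iI; rewrite -(card_imset _ (@lift_inj _ i)); apply: eq_card => j.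
apply/imsetP/idP => [[l]|jI]; first by rewrite inE => ? ->.
case: (unliftP i j) jI => [l ->|->]; last by rewrite (negPf iI).
by exists l; rewrite ?inE.
Qed.

Lemma embed_degree i p (w : koszul k n) :
  form_degree p w -> form_degree p (embed i w).
Proof.
move=> hw I hI; rewrite ffunE; case: ifPn => // iI.
by rewrite hw ?linear0 // card_preim_lift.
Qed.

Lemma ext_degree i H p w : is_homotopy H ->
  form_degree p w -> form_degree p.+1 (ext i H w).
Proof.
move=> [_ degH] hw J hJ; rewrite sum_ffunE big1 // => I iI.
have [cardI|cardI] := eqVneq #|I| p; last first.
  by rewrite hw // msupp0 big_nil ffunE.
rewrite sum_ffunE big1 // => m _; rewrite ffunE.
suff deg : form_degree p.+1 (embed i (H (kform 'X_[mrestr i m] (lift i @^-1: I)))).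
  by rewrite (kscale_degree _ deg hJ) scaler0.
apply: embed_degree; apply: degH => J' hJ'; rewrite ffunE; case: eqP => // eJ'.
by rewrite eJ' card_preim_lift // cardI eqxx in hJ'.
Qed.

Lemma mext_mrestr i (m : 'X_{1..n.+1 + n.+1}) :
  m (yi i) = 0%N -> mext i (m (xi i)) (mrestr i m) = m.
Proof.
move=> my; apply/mnmP => l.
(* Every variable is x_i, y_i or of the form [vlift i j]; this settles the last kind. *)
have vE j : mext i (m (xi i)) (mrestr i m) (vlift i j) = m (vlift i j).
  have /mnmP/(_ j) := mextK i (m (xi i)) (mrestr i m).
  by rewrite !mnmE.
rewrite -(splitK l); case: (split l) => a /=.
  case: (unliftP i a) => [b ->|->]; last by rewrite -/(xi i) mext_xi.
  by have := vE (xi b); rewrite /vlift split_xi.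
case: (unliftP i a) => [b ->|->]; last by rewrite -/(yi i) mext_yi my.
by have := vE (yi b); rewrite /vlift split_yi.
Qed.

Lemma kscale_embed_kform i I (m : 'X_{1..n.+1 + n.+1}) :
    i \notin I -> m (yi i) = 0%N ->
  kscale ('X_(xi i) ^+ m (xi i))
    (embed i (kform 'X_[mrestr i m] (lift i @^-1: I))) = kform 'X_[k, m] I.
Proof.
move=> iI my; apply/ffunP => J; rewrite !ffunE; case: ifPn => iJ.
  by rewrite mulr0; case: eqP => // e; rewrite e (negPf iI) in iJ.
have -> : (lift i @^-1: J == lift i @^-1: I) = (J == I).
  apply/eqP/eqP => [/setP e|-> //]; apply/setP => j.
  case: (unliftP i j) => [l ->|->]; last by rewrite (negPf iI) (negPf iJ).
  by have := e l; rewrite !inE.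
case: eqP => _; last by rewrite linear0 mulr0.
by rewrite rename_mpolyE msuppX big_seq1 mcoeffX eqxx scale1r mext_mrestr.
Qed.

(** The forms x_i^a * [embed i w] span the image of pr_i over k, and on them [ext_embed] computes
    the extension; identities linear in the form need only be checked there. *)
Lemma pr_ind i (P : koszul k n.+1 -> Prop) :
    P 0 -> (forall c u v, P u -> P v -> P (c *: u + v)) ->
    (forall a w, P (kscale ('X_(xi i) ^+ a) (embed i w))) ->
  forall w, P (pr i w).
Proof.
move=> P0 Plin Pbase w; set v := pr i w.
(* The restricted ranges lose nothing: pr_i removes the multiples of theta_i and its coefficients
   are y_i-free. *)
have -> : v = \sum_(I : {set 'I_n.+1} | i \notin I)
    \sum_(m <- msupp (v I) | m (yi i) == 0%N) (v I)@_m *: kform 'X_[m] I.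
  apply/ffunP => J; rewrite sum_ffunE.
  have [iJ|iJ] := boolP (i \in J).
    rewrite big1 ?ffunE ?iJ // => I iI; rewrite sum_ffunE big1 // => m _.
    by rewrite !ffunE; case: eqP => [e|]; rewrite ?scaler0 // -e iJ in iI *.
  rewrite (bigD1 J) //= [X in _ = _ + X]big1 ?addr0; last first.
    move=> I /andP[_ IJ]; rewrite sum_ffunE big1 // => m _.
    by rewrite !ffunE eq_sym (negPf IJ) scaler0.
  rewrite sum_ffunE {1}(mpolyE (v J)) big_seq [RHS]big_seq_cond.
  apply: eq_big => [m|m _]; last by rewrite !ffunE eqxx.
  have /allP := y_free_subst_yx i (w J).
  case mv: (m \in msupp _) => //= /(_ m) -> //.
  by move: mv; rewrite ffunE (negPf iJ).
have PD u1 u2 : P u1 -> P u2 -> P (u1 + u2).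
  by move=> P1 P2; rewrite -[u1]scale1r; apply: Plin.
apply: big_ind => // I iI; apply: big_ind => // m /eqP my.
by rewrite -[X in P X]addr0; apply: Plin => //; rewrite -(kscale_embed_kform iI).
Qed.

(** [lift i] preserves the order, so the same number of indices precedes; renaming variables fixes
    signs. *)
Lemma ksign_lift i (l : 'I_n) I : i \notin I ->
  ksign k (lift i l) I =
  ksign k l (lift i @^-1: I) \mPo [tuple 'X_(vlift i j) | j < n + n].
Proof.
move=> iI; rewrite /ksign rmorphXn rmorphN rmorph1; congr (_ ^+ _).
rewrite -(card_preim_lift (i := i)); last by rewrite inE (negPf iI).
apply: eq_card => j; rewrite !inE; congr (_ && _).
by rewrite !ltnNge leq_bump2.
Qed.

Lemma Delta_lift i (l : 'I_n) :
  Delta k (lift i l) = Delta k l \mPo [tuple 'X_(vlift i j) | j < n + n].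
Proof.
rewrite /Delta comp_mpolyB !comp_mpolyXU -!tnth_nth !tnth_mktuple /vlift.
by rewrite split_xi split_yi.
Qed.

(** The summand for [i] vanishes because embedded forms contain no theta_i; the other summands are
    renumbered by [lift i]. *)
Lemma koszul_d_embed i (w : koszul k n) :
  koszul_d (embed i w) = embed i (koszul_d w).
Proof.
apply/ffunP => I; rewrite !ffunE; case: ifPn => iI.
  by rewrite big1 // => j jI; rewrite ffunE in_setU1 iI orbT mulr0.
rewrite (bigD1_ord i) //= ffunE setU11 mulr0 add0r linear_sum /=.
apply: eq_big => [l|l lI]; first by rewrite inE.
rewrite !rmorphM /= -ksign_lift // -Delta_lift ffunE.
rewrite in_setU1 (negPf iI) (negPf (neq_lift _ _)).
suff -> : lift i @^-1: (lift i l |: I) = l |: (lift i @^-1: I) by [].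
by apply/setP => j; rewrite !inE (inj_eq lift_inj).
Qed.

Lemma augm_kscale_embed i a (w : koszul k n) :
  augm (kscale ('X_(xi i) ^+ a) (embed i w))
  = kscale ('X_(xi i) ^+ a) (embed i (augm w)).
Proof.
apply/ffunP => I; rewrite !ffunE inE.
have [->|I0] := eqVneq I set0; last first.
  case: ifPn => iI; rewrite ?mulr0 //.
  suff /negPf -> : lift i @^-1: I != set0 by rewrite linear0 mulr0.
  by rewrite -card_gt0 card_preim_lift // card_gt0.
rewrite inE preimset0 eqxx /subst_all rmorphM rmorphXn /=; congr (_ ^+ _ * _).
  by rewrite comp_mpolyXU -tnth_nth tnth_mktuple split_xi.
rewrite !comp_mpolyA; congr comp_mpoly; apply: eq_from_tnth => j.
rewrite !tnth_mktuple comp_mpolyXU -tnth_nth tnth_mktuple /vlift.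
by case: (split j) => b; rewrite ?split_xi ?split_yi comp_mpolyXU -tnth_nth
  tnth_mktuple /vlift split_xi.
Qed.

Lemma ext_pr_contracts i H w : linear H -> contracts H ->
  koszul_d (ext i H (pr i w)) + ext i H (koszul_d (pr i w)) = pr i w - augm w.
Proof.
(* Now both sides depend on [pr i w] alone, so [pr_ind] applies; on the spanning forms x_i^a and
   [embed] factor out, leaving the contraction identity of [H]. *)
move=> linH contrH; rewrite -(augm_pr i).
pose P v := koszul_d (ext i H v) + ext i H (koszul_d v) = v - augm v.
apply: (@pr_ind i P) w => [|c u v hu hv|a w]; rewrite /P.
- by rewrite !linear0 addr0.
- rewrite !linearP /= addrACA -scalerDr hu hv.
  by rewrite scalerDr addrACA.
- rewrite augm_kscale_embed koszul_d_kscale koszul_d_embed !ext_embed //.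
  rewrite koszul_d_kscale koszul_d_embed -!linearD /= contrH.
  by rewrite -!linearB.
Qed.

End Extension.

(** * The family of homotopies, its contraction property and uniqueness *)

Fixpoint homotopy (k : fieldType) n : koszul k n -> koszul k n :=
  if n is m.+1 then
    fun w => hmean w + m.+1%:R^-1 *: \sum_(i < m.+1) ext i (@homotopy k m) (pr i w)
  else fun=> 0.

Lemma homotopyS (k : fieldType) n (w : koszul k n.+1) :
  homotopy w
  = hmean w + n.+1%:R^-1 *: \sum_(i < n.+1) ext i (@homotopy k n) (pr i w).
Proof. by []. Qed.

Lemma homotopy_is_homotopy (k : fieldType) n : is_homotopy (@homotopy k n).
Proof.
elim: n => [|n IHn].
  by split => [c u v|p w _ I _]; rewrite ?scaler0 ?addr0 ?ffunE.
split => [c u v|p w hw I hI] /=.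
  rewrite linearP /= [in RHS]scalerDr [in RHS]addrACA; congr (_ + _).
  rewrite [in RHS]scalerA mulrC -[in RHS]scalerA -scalerDr; congr (_ *: _).
  by rewrite scaler_sumr -big_split; apply: eq_bigr => i _; rewrite !linearP.
rewrite 3!ffunE !sum_ffunE !big1 ?scaler0 ?addr0 // => i _.
  by rewrite (ext_degree i IHn (pr_degree i hw)).
by rewrite (hmap_degree i hw).
Qed.

Lemma homotopy_contracts (k : fieldType) n : [pchar k] =i pred0 ->
  contracts (@homotopy k n).
Proof.
move=> k_char0; elim: n => [|n IHn] w.
  (* Without variables the only index set is empty and [augm] is the identity. *)
  rewrite /= linear0 addr0; apply/esym/eqP; rewrite subr_eq0; apply/eqP/ffunP => I.
  have -> : I = set0 by apply/setP => -[].
  rewrite ffunE eqxx /subst_all -[LHS]comp_mpoly_id; congr comp_mpoly.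
  by apply: eq_from_tnth => -[].
(* Characteristic zero makes n+1 invertible, so the average can be cleared of its denominator. *)
have n0 : n.+1%:R != 0 :> k by have /pcharf0P -> := k_char0.
rewrite /= /hmean -!scalerDr linearZ -scalerDr.
apply: (scalerI n0); rewrite scalerA divff // scale1r.
rewrite linearD !linear_sum /= addrACA -!big_split /=.
(* For each i, the parts id - pr_i and pr_i - p telescope to a value independent of i. *)
rewrite (eq_bigr (fun=> w - augm w)) => [|i _].
  by rewrite sumr_const card_ord scaler_nat.
rewrite hmap_contracts -koszul_d_pr ext_pr_contracts ?addrA ?subrK //.
exact: (proj1 (homotopy_is_homotopy k n)).
Qed.

Theorem lemma4p5 (k : fieldType) (k_char0 : [pchar k] =i pred0) :
  exists H : forall n : nat, koszul k n -> koszul k n,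
    [/\ homotopy_family H,
        forall H' : (forall n : nat, koszul k n -> koszul k n),
          homotopy_family H' ->
          forall n, (0 < n)%N -> forall w : koszul k n, H' n w = H n w
      & forall n, (0 < n)%N -> contracts (H n)].
Proof.
(* The extension of the zero map vanishes and the mean has a single term. *)
have homotopy1 w : @homotopy k 1 w = hmap ord0 w.
  rewrite /= /hmean !big_ord1 invr1 !scale1r /ext big1 ?addr0 // => I _.
  by rewrite big1 // => m _; rewrite !linear0.
exists (@homotopy k); split => [|H' [_ H'1 H'S] n n_gt0|n _].
- by split => // n _; apply: homotopy_is_homotopy.
(* The induction effectively starts at 1, since [H'] is unconstrained at 0; above that the recursion
   determines [H'] from its predecessor. *)
- elim: n n_gt0 => // -[|n] IHn _ w; first by rewrite H'1 homotopy1.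
  rewrite (H'S n.+1 isT) (homotopyS w).
  by rewrite (eq_bigr _ (fun i _ => eq_ext i (IHn isT) (pr i w))).
- exact: homotopy_contracts.
Qed.
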